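(* In Resilient TX10, for every closed statement $s$ with $\mathsf{noAsync}(s)$ and $\mathsf{isLocal}(s)$ and every global heap $g$, $\langle\{\mathtt{skip}\ s\},g\rangle\equiv\langle s,g\rangle$, where $\equiv$ is weak bisimilarity for Resilient TX10.
   Context: **Syntax.** $\mathsf{Pl}=\{0,\dots,n-1\}$ is a finite set of places (ranged over by $p,q$). $\mathsf{ObjId}$ is an infinite set of object ids with a fixed bijection with $\mathbb N$ (the enumeration order); $\mathsf p:\mathsf{ObjId}\to\mathsf{Pl}$ gives the home place; $\mathsf{ObjId}_q=\{o:\mathsf p(o)=q\}$; global references are $\mathsf{grObjId}=\{o\$p : o\in\mathsf{ObjId}_p\}$. Values $v$: object ids $o$, global references $o\$p$, exception constants $\mathsf E,\mathsf{BF},\mathsf{BG},\mathsf{DP}$. Expressions: $e::= v\mid x\mid e.f\mid\{f_1{:}e_1,\dots,f_n{:}e_n\}\mid \mathtt{globalref}\ e\mid\mathtt{valof}\ e$. Statements: $s,t::=\mathtt{skip}\mid\mathtt{throw}\ v$ ($v$ an exception constant) $\mid \mathtt{val}\ x=e\ s\mid e.f=e'\mid\{s\ t\}\mid\mathtt{at}(p)(\mathtt{val}\ x=e)\,s\mid\mathtt{async}\ s\mid\mathtt{finish}\ s\mid\mathtt{try}\ s\ \mathtt{catch}\ t$, plus the dynamic (runtime only) statements $\overline{\mathtt{at}}(p)\,s\mid\overline{\mathtt{async}}\,s\mid\mathtt{finish}_\mu\,s$ with $\mu$ a finite set of exception values; $\mathtt{finish}\ s$ abbreviates $\mathtt{finish}_\emptyset\,s$.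 In $\mathtt{val}\ x=e\ s$ and $\mathtt{at}(p)(\mathtt{val}\ x=e)s$ the only free variable of $s$ is $x$. A configuration is closed if its statement has no free variables. $\mathsf{noAsync}(s)$: $s$ has no subterm of the form $\mathtt{async}\,s'$ or $\overline{\mathtt{async}}\,s'$ (so $s$ cannot evolve to an asynchronous statement). $\mathsf{isLocal}(s)$: $s$ has no substatement of the form $\overline{\mathtt{at}}(q)s'$. **Heaps.** A local heap $h$ is a finite partial map from object ids to objects, an object being a finite partial map from field names to values. A global heap $g$ is a partial map from $\mathsf{Pl}$ to local heaps; $\mathrm{dom}(g)$ is the set of non-failed places. $f[a\mapsto b]$ denotes map update. For $o\in\mathrm{dom}(h)$, $h_o$ is the set of object ids (local or global) reachable from $o$ in $h$ via fields. $g$ is place-local if for every $q\in\mathrm{dom}(g)$, with $h=g(q)$: $\mathrm{dom}(h)\subseteq\mathsf{ObjId}_q$ and $h_o\subseteq(\mathsf{ObjId}_q\cap\mathrm{dom}(h))\cup\mathsf{grObjId}$ for all $o\in\mathrm{dom}(h)$. **Predicates.** $\mathsf{isAsync}(\overline{\mathtt{async}}\,s)$; $\mathsf{isAsync}(s)$ implies $\mathsf{isAsync}(\overline{\mathtt{at}}(p)s)$ and $\mathsf{isAsync}(\mathtt{try}\,s\,\mathtt{catch}\,t)$; $\mathsf{isAsync}(s)$ and $\mathsf{isAsync}(t)$ imply $\mathsf{isAsync}(\{s\ t\})$. $\mathsf{isSync}$ holds of $\mathtt{skip}$, $\mathtt{val}\ x=e\ s$, $e.f=e'$, $\mathtt{at}(p)(\mathtt{val}\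 x=e)s$, $\mathtt{async}\ s$, $\mathtt{finish}_\mu\,s$, $\mathtt{throw}\ v$; and $\mathsf{isSync}(s)$ implies $\mathsf{isSync}$ of $\{s\ t\}$, $\{t\ s\}$, $\overline{\mathtt{at}}(p)s$, $\mathtt{try}\,s\,\mathtt{catch}\,t$. **Transitions.** Configurations $k$ are $\langle s,g\rangle$ or $g$ (terminated). Labels $\lambda$: $\epsilon$ (normal), $v\otimes$ (synchronous exception), $v\times$ (asynchronous exception). $\to_p$ means $\xrightarrow{\epsilon}_p$. In rules, ''$A\mid B$'' in premise and conclusion denotes two rules, matching first with first and second with second. *Expressions* (at place $p$, local heap $h$): $\langle\{f_1{:}v_1,\dots,f_n{:}v_n\},h\rangle\to_p\langle o,h[o\mapsto\{f_i\mapsto v_i\}]\rangle$ with $o\in\mathsf{ObjId}_p\setminus\mathrm{dom}(h)$; $\langle o.f,h\rangle\to_p\langle v,h\rangle$ if $h(o)(f)=v$; $\langle o.f,h\rangle\xrightarrow{\mathsf{BF}\otimes}_p h$ if $f\notin\mathrm{dom}(h(o))$; $\langle\mathtt{globalref}\ o,h\rangle\to_p\langle o\$p,h\rangle$; $\langle\mathtt{valof}\ o\$p,h\rangle\to_p\langle o,h\rangle$; $\langle\mathtt{valof}\ v,h\rangle\xrightarrow{\mathsf{BG}\otimes}_p h$ if $v$ is not of the form $o\$p$; and if $\langle e,h\rangle\xrightarrow{\lambda}_p\langle e',h'\rangle\mid h$ then the same label is taken in the contexts $[\,].f$, $\mathtt{globalref}\,[\,]$, $\mathtt{valof}\,[\,]$,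 $\{f_1{:}v_1,\dots,f_i{:}v_i,f_{i+1}{:}[\,],\dots\}$ (leading to $h$ in the exceptional case). *Basic statements* (all require $p\in\mathrm{dom}(g)$): $\langle\mathtt{skip},g\rangle\to_p g$; $\langle\mathtt{throw}\ v,g\rangle\xrightarrow{v\otimes}_p g$; if $\langle s[v/x],g\rangle\xrightarrow{\lambda}_p\langle s',g'\rangle\mid g'$ then $\langle\mathtt{val}\ x=v\ s,g\rangle\xrightarrow{\lambda}_p\langle s',g'\rangle\mid g'$; $\langle o.f=v,g\rangle\to_p g[p\mapsto g(p)[o\mapsto g(p)(o)[f\mapsto v]]]$ if $f\in\mathrm{dom}(g(p)(o))$; $\langle o.f=v,g\rangle\xrightarrow{\mathsf{BF}\otimes}_p g$ if $f\notin\mathrm{dom}(g(p)(o))$; (Ctx) if $\langle e,g(p)\rangle\xrightarrow{\lambda}_p\langle e',h'\rangle\mid h'$ and $g'=g[p\mapsto h']$ then $\mathtt{val}\ x=e\ s$, $e.f=e_1$, $o.f=e$, $\mathtt{at}(q)(\mathtt{val}\ x=e)s$ in heap $g$ make a $\lambda$-step at $p$ to the same statement with $e'$ for $e$ in heap $g'$, resp. to $g'$. *Copy.* For $o\in\mathsf{ObjId}$ and $q\in\mathrm{dom}(g)$, $\mathsf{copy}(o,q,g)=(o',g[q\mapsto h'])$ where $h'$ extends $h=g(q)$ by a fresh isomorphic copy, rooted at $o'$, of the object graph reachable from $o$ in $g(\mathsf p(o))$; the new ids are the next unused elements of $\mathsf{ObjId}_q$ and global references are preserved unchanged. For other values $\mathsf{copy}(v,q,g)=(v,g)$.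 *Remaining Resilient TX10 rules:* (Place Failure) for $p\in\mathrm{dom}(g)$, $p\neq0$: $\langle s,g\rangle\to_p\langle s,g\setminus\{(p,g(p))\}\rangle$. (Local Failure) if $p\notin\mathrm{dom}(g)$, each of $\mathtt{skip}$, $\mathtt{throw}\ v$, $\mathtt{val}\ x=e\ s$, $e_1.f=e_2$ in heap $g$ makes a step $\xrightarrow{\mathsf{DP}\otimes}_p g$. (Spawn) $\langle\mathtt{async}\ s,g\rangle\to_p\langle\overline{\mathtt{async}}\,s,g\rangle$ if $p\in\mathrm{dom}(g)$; $\langle\mathtt{async}\ s,g\rangle\xrightarrow{\mathsf{DP}\otimes}_p g$ if $p\notin\mathrm{dom}(g)$. (Async) if $\langle s,g\rangle\xrightarrow{\lambda}_p\langle s',g'\rangle\mid g'$ then $\langle\overline{\mathtt{async}}\,s,g\rangle\xrightarrow{\lambda'}_p\langle\overline{\mathtt{async}}\,s',g'\rangle\mid g'$, with $\lambda'=\epsilon$ if $\lambda=\epsilon$ and $\lambda'=v\times$ if $\lambda\in\{v\times,v\otimes\}$. (Finish) if $\langle s,g\rangle\xrightarrow{\lambda}_p\langle s',g'\rangle$ then $\langle\mathtt{finish}_\mu s,g\rangle\to_p\langle\mathtt{finish}_{\mu\cup\lambda}s',g'\rangle$, where $\mu\cup\epsilon=\mu$ and $\mu\cup v\times=\mu\cup v\otimes=\mu\cup\{v\}$. (End of Finish) if $\langle s,g\rangle\xrightarrow{\lambda}_p g'$ then $\langle\mathtt{finish}_\mu s,g\rangle\xrightarrow{\lambda'}_p g'$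 with $\lambda'=\epsilon$ if $\mu\cup\lambda=\emptyset$; otherwise $\lambda'=\mathsf E\otimes$ if $p\in\mathrm{dom}(g)$ and $\lambda'=\mathsf{DP}\otimes$ if $p\notin\mathrm{dom}(g)$. (Seq) if $\langle s,g\rangle\xrightarrow{\lambda}_p\langle s',g'\rangle$: $\langle\{s\ t\},g\rangle\xrightarrow{\lambda}_p\langle\{s'\ t\},g'\rangle$ if $\lambda\in\{\epsilon,v\times\}$, and $\langle\{s\ t\},g\rangle\xrightarrow{\lambda}_p\langle s',g'\rangle$ if $\lambda=v\otimes$. (Par) if $\mathsf{isAsync}(t)$ and $\langle s,g\rangle\xrightarrow{\lambda}_p\langle s',g'\rangle\mid g'$ then $\langle\{t\ s\},g\rangle\xrightarrow{\lambda}_p\langle\{t\ s'\},g'\rangle\mid\langle t,g'\rangle$. (Seq Term) if $p\in\mathrm{dom}(g)$ and $\langle s,g\rangle\xrightarrow{\lambda}_p g'$: $\langle\{s\ t\},g\rangle\xrightarrow{\lambda}_p\langle t,g'\rangle$ if $\lambda\in\{\epsilon,v\times\}$, and $\langle\{s\ t\},g\rangle\xrightarrow{\lambda}_p g'$ if $\lambda=v\otimes$. (Seq Failed Term) if $p\notin\mathrm{dom}(g)$ and $\langle s,g\rangle\xrightarrow{\lambda}_p g'$: $\langle\{s\ t\},g\rangle\xrightarrow{\mathsf{DP}\otimes}_p g'$ if $\mathsf{isSync}(s)$, and $\langle\{s\ t\},g\rangle\xrightarrow{\mathsf{DP}\times}_p\langle t,g'\rangle$ if $\mathsf{isAsync}(s)$.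 (Place Shift) if $p,q\in\mathrm{dom}(g)$ and $(v',g')=\mathsf{copy}(v,q,g)$, $\langle\mathtt{at}(q)(\mathtt{val}\ x=v)s,g\rangle\to_p\langle\overline{\mathtt{at}}(q)\{s[v'/x]\ \mathtt{skip}\},g'\rangle$; if $q\notin\mathrm{dom}(g)$ or $p\notin\mathrm{dom}(g)$, $\langle\mathtt{at}(q)(\mathtt{val}\ x=e)s,g\rangle\xrightarrow{\mathsf{DP}\otimes}_p g$. (At) if $\langle s,g\rangle\xrightarrow{\lambda}_q\langle s',g'\rangle\mid g'$ then $\langle\overline{\mathtt{at}}(q)s,g\rangle\xrightarrow{\lambda'}_p\langle\overline{\mathtt{at}}(q)s',g'\rangle\mid g'$, where $\lambda'=\mathsf{DP}\otimes$ if $\lambda=v\otimes$ and $p\notin\mathrm{dom}(g)$, and $\lambda'=\lambda$ otherwise. (Try) if $\langle s,g\rangle\xrightarrow{\lambda}_p\langle s',g'\rangle\mid g'$: if $\lambda\in\{\epsilon,v\times\}$, $\langle\mathtt{try}\,s\,\mathtt{catch}\,t,g\rangle\xrightarrow{\lambda}_p\langle\mathtt{try}\,s'\,\mathtt{catch}\,t,g'\rangle\mid g'$; if $p\in\mathrm{dom}(g)$, $\lambda=v\otimes$, $\langle\mathtt{try}\,s\,\mathtt{catch}\,t,g\rangle\to_p\langle\{s'\ t\},g'\rangle\mid\langle t,g'\rangle$; if $p\notin\mathrm{dom}(g)$, $\lambda=\mathsf{DP}\otimes$, $\langle\mathtt{try}\,s\,\mathtt{catch}\,t,g\rangle\xrightarrow{\lambda}_p\langle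 s',g'\rangle\mid g'$. **Weak bisimulation (resilient).** A resilient environment move is a map $\Phi$ on global heaps such that $\Phi(g)$ is place-local whenever $g$ is, $\mathrm{dom}(\Phi(g))\subseteq\mathrm{dom}(g)$, and $\mathrm{dom}(g(p))\subseteq\mathrm{dom}(\Phi(g)(p))$ for all $p\in\mathrm{dom}(\Phi(g))$. $\overset{\lambda}{\Longrightarrow}_p$ is $(\to_p)^*\xrightarrow{\lambda}_p(\to_p)^*$ if $\lambda\neq\epsilon$, and $(\to_p)^*$ if $\lambda=\epsilon$. A binary relation $\mathcal R$ on closed configurations is a weak bisimulation if: (1) $g\,\mathcal R\,k$ implies $k=g$; (2) $\langle s,g\rangle\,\mathcal R\,k$ implies $k=\langle t,g\rangle$ for some $t$, $\mathsf{isSync}(s)$ iff $\mathsf{isSync}(t)$, and for every resilient environment move $\Phi$ and every place $p$: (a) if $\langle s,\Phi(g)\rangle\xrightarrow{\lambda}_p\langle s',g'\rangle$ then for some $t'$, $\langle t,\Phi(g)\rangle\overset{\lambda}{\Longrightarrow}_p\langle t',g'\rangle$ and $\langle s',g'\rangle\,\mathcal R\,\langle t',g'\rangle$, and vice versa; (b) if $\langle s,\Phi(g)\rangle\xrightarrow{\lambda}_p g'$ then $\langle t,\Phi(g)\rangle\overset{\lambda}{\Longrightarrow}_p g'$, and vice versa. Weak bisimilarity $\equiv$ is the largest weak bisimulation. *)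

(* Defs.v *)
From Stdlib Require Import Relations.
From HB Require Import structures.
From mathcomp Require Import all_boot.
From mathcomp Require Import finmap.

Set Implicit Arguments.
Unset Strict Implicit.
Unset Printing Implicit Defensive.

Local Open Scope fset_scope.
Local Open Scope fmap_scope.

(* ObjId is identified with nat along its fixed bijection with the natural
   numbers, so the enumeration order is the order of nat. *)
Definition objid := nat.
Definition var := nat.
Definition fname := nat.

Inductive exn := exE | exBF | exBG | exDP.

Definition exn_code (v : exn) : bool * bool :=
  match v with
  | exE => (false, false) | exBF => (false, true)
  | exBG => (true, false) | exDP => (true, true)
  end.

Definition exn_decode (b : bool * bool) : exn :=
  match b with
  | (false, false) => exE | (false, true) => exBF
  | (true, false) => exBG | (true, true) => exDP
  end.

Lemma exn_codeK : cancel exn_code exn_decode.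
Proof. by case. Qed.

HB.instance Definition _ := Finite.copy exn (can_type exn_codeK).

(* Global references o$p exist only for p the home place of o, so [Vgref o]
   stands for o$(home o), and "v is of the form o$p" reads "v is [Vgref o]
   with home o = p". *)
Inductive value :=
| Vobj (o : objid)
| Vgref (o : objid)
| Vexn (v : exn).

Inductive expr :=
| Eval (v : value)
| Evar (x : var)
| Efield (e : expr) (f : fname)
| Erec (fs : seq (fname * expr))
| Eglobalref (e : expr)
| Evalof (e : expr).

(* [SatD] and [SasyncD] are the runtime-only overlined at and async;
   [finish s] is [Sfinish set0 s]. *)
Inductive stmt (n : nat) :=
| Sskip
| Sthrow (v : exn)
| Sval (x : var) (e : expr) (s : stmt n)
| Sassign (e : expr) (f : fname) (e' : expr)
| Sseq (s t : stmt n)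
| Sat (q : 'I_n) (x : var) (e : expr) (s : stmt n)
| Sasync (s : stmt n)
| Sfinish (mu : {set exn}) (s : stmt n)
| Stry (s t : stmt n)
| SatD (q : 'I_n) (s : stmt n)
| SasyncD (s : stmt n).

Arguments Sskip {n}.
Arguments Sthrow {n} v.
Arguments Sassign {n} e f e'.

Fixpoint fv_expr (e : expr) : seq var :=
  match e with
  | Eval _ => [::]
  | Evar x => [:: x]
  | Efield e _ | Eglobalref e | Evalof e => fv_expr e
  | Erec fs => flatten (map (fun fe => let: (_, e) := fe in fv_expr e) fs)
  end.

Fixpoint fv_stmt n (s : stmt n) : seq var :=
  match s with
  | Sskip | Sthrow _ => [::]
  | Sval x e s | Sat _ x e s => fv_expr e ++ filter (predC1 x) (fv_stmt s)
  | Sassign e _ e' => fv_expr e ++ fv_expr e'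
  | Sseq s t | Stry s t => fv_stmt s ++ fv_stmt t
  | Sasync s | Sfinish _ s | SatD _ s | SasyncD s => fv_stmt s
  end.

(* The side condition of the grammar: the body s of [val x = e s] and of
   [at(q)(val x = e) s] has no free variable other than x. *)
Fixpoint wf_stmt n (s : stmt n) : bool :=
  match s with
  | Sskip | Sthrow _ | Sassign _ _ _ => true
  | Sval x _ s | Sat _ x _ s => all (pred1 x) (fv_stmt s) && wf_stmt s
  | Sseq s t | Stry s t => wf_stmt s && wf_stmt t
  | Sasync s | Sfinish _ s | SatD _ s | SasyncD s => wf_stmt s
  end.

Definition closed_stmt n (s : stmt n) : Prop := fv_stmt s = [::].

Fixpoint subst_expr (x : var) (v : value) (e : expr) : expr :=
  match e with
  | Eval w => Eval w
  | Evar y => if y == x then Eval v else Evar y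
  | Efield e f => Efield (subst_expr x v e) f
  | Erec fs =>
      Erec (map (fun fe => let: (f, e) := fe in (f, subst_expr x v e)) fs)
  | Eglobalref e => Eglobalref (subst_expr x v e)
  | Evalof e => Evalof (subst_expr x v e)
  end.

Fixpoint subst_stmt n (x : var) (v : value) (s : stmt n) : stmt n :=
  match s with
  | Sskip => Sskip
  | Sthrow w => Sthrow w
  | Sval y e s =>
      Sval y (subst_expr x v e) (if y == x then s else subst_stmt x v s)
  | Sassign e f e' => Sassign (subst_expr x v e) f (subst_expr x v e')
  | Sseq s t => Sseq (subst_stmt x v s) (subst_stmt x v t)
  | Sat q y e s =>
      Sat q y (subst_expr x v e) (if y == x then s else subst_stmt x v s)
  | Sasync s => Sasync (subst_stmt x v s)
  | Sfinish mu s => Sfinish mu (subst_stmt x v s)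
  | Stry s t => Stry (subst_stmt x v s) (subst_stmt x v t)
  | SatD q s => SatD q (subst_stmt x v s)
  | SasyncD s => SasyncD (subst_stmt x v s)
  end.

Fixpoint noAsync n (s : stmt n) : bool :=
  match s with
  | Sasync _ | SasyncD _ => false
  | Sskip | Sthrow _ | Sassign _ _ _ => true
  | Sval _ _ s | Sat _ _ _ s | Sfinish _ s | SatD _ s => noAsync s
  | Sseq s t | Stry s t => noAsync s && noAsync t
  end.

Fixpoint isLocal n (s : stmt n) : bool :=
  match s with
  | SatD _ _ => false
  | Sskip | Sthrow _ | Sassign _ _ _ => true
  | Sval _ _ s | Sat _ _ _ s | Sfinish _ s | Sasync s | SasyncD s => isLocal s
  | Sseq s t | Stry s t => isLocal s && isLocal t
  end.

Fixpoint isAsync n (s : stmt n) : bool :=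
  match s with
  | SasyncD _ => true
  | SatD _ s | Stry s _ => isAsync s
  | Sseq s t => isAsync s && isAsync t
  | _ => false
  end.

Fixpoint isSync n (s : stmt n) : bool :=
  match s with
  | Sskip | Sval _ _ _ | Sassign _ _ _ | Sat _ _ _ _ | Sasync _
  | Sfinish _ _ | Sthrow _ => true
  | Sseq s t => isSync s || isSync t
  | SatD _ s | Stry s _ => isSync s
  | SasyncD _ => false
  end.

Definition obj := {fmap fname -> value}.
Definition lheap := {fmap objid -> obj}.
Definition gheap (n : nat) := {fmap 'I_n -> lheap}.

(* With duplicated field names the rightmost one wins. *)
Definition mkobj (ws : seq (fname * value)) : obj :=
  foldl (fun m fw => m.[fw.1 <- fw.2]) [fmap] ws.

Definition is_ref (v : value) : bool :=
  match v with Vobj _ | Vgref _ => true | Vexn _ => false end.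

(* [reach h o v]: v belongs to h_o. Global references are reached, but not
   traversed. *)
Inductive reach (h : lheap) (o : objid) : value -> Prop :=
| reach_root : reach h o (Vobj o)
| reach_field o1 (ob : obj) f v :
    reach h o (Vobj o1) -> h.[? o1] = Some ob -> ob.[? f] = Some v ->
    is_ref v -> reach h o v.

Definition place_local n (home : objid -> 'I_n) (g : gheap n) : Prop :=
  forall q (h : lheap), g.[? q] = Some h ->
    (forall o, o \in domf h -> home o = q) /\
    (forall o, o \in domf h -> forall v, reach h o v ->
       (exists o1, [/\ v = Vobj o1, home o1 = q & o1 \in domf h]) \/
       (exists o1, v = Vgref o1)).

Definition rename_value (rho : objid -> objid) (v : value) : value :=
  match v with
  | Vobj o => Vobj (rho o)
  | Vgref _ | Vexn _ => v
  end.

Definition rename_obj (rho : objid -> objid) (ob : obj) : obj :=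
  [fmap f : domf ob => rename_value rho (ob f)].

(* The graph of the partial function copy(o, q, g) = (o', g[q |-> h']). The
   renaming rho maps the objects reachable from o, in enumeration order, to the
   first elements of ObjId_q outside dom(g(q)). Nothing is related to o if its
   object graph is not entirely allocated in g(home o). *)
Definition copy_obj n (home : objid -> 'I_n)
    (o : objid) (q : 'I_n) (g : gheap n) (o' : objid) (g' : gheap n) : Prop :=
  exists (src h h' : lheap) (rho : objid -> objid),
    let D x := reach src o (Vobj x) in
    g.[? home o] = Some src /\ g.[? q] = Some h /\
    (forall x, D x -> x \in domf src) /\
    (forall x y, D x -> D y -> x < y -> rho x < rho y) /\
    (forall x, D x -> home (rho x) = q /\ rho x \notin domf h) /\
    (forall x y, D x -> y < rho x -> home y = q -> y \notin domf h ->
       exists2 z, D z & rho z = y) /\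
    (forall x, D x -> h'.[? rho x] = omap (rename_obj rho) src.[? x]) /\
    (forall y, (forall x, D x -> rho x <> y) -> h'.[? y] = h.[? y]) /\
    o' = rho o /\ g' = g.[q <- h'].

Definition copy n (home : objid -> 'I_n)
    (v : value) (q : 'I_n) (g : gheap n) (v' : value) (g' : gheap n) : Prop :=
  match v with
  | Vobj o => exists2 o', v' = Vobj o' & copy_obj home o q g o' g'
  | Vgref _ | Vexn _ => v' = v /\ g' = g
  end.

Inductive label :=
| Leps
| Lsync (v : exn)    (* v⊗ *)
| Lasync (v : exn).  (* v× *)

Definition is_Lsync (l : label) : bool :=
  if l is Lsync _ then true else false.

Definition add_label (mu : {set exn}) (l : label) : {set exn} :=
  match l with
  | Leps => mu
  | Lsync v | Lasync v => (v |: mu)%SET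
  end.

Definition async_label (l : label) : label :=
  match l with
  | Leps => Leps
  | Lsync v | Lasync v => Lasync v
  end.

Inductive econf :=
| ERun (e : expr) (h : lheap)
| EDone (h : lheap).

Inductive conf (n : nat) :=
| Run (s : stmt n) (g : gheap n)
| Done (g : gheap n).

Arguments Done {n} g.

Definition vals (ws : seq (fname * value)) : seq (fname * expr) :=
  [seq (fw.1, Eval fw.2) | fw <- ws].

Inductive ectx :=
| Cfield (f : fname)
| Cglobalref
| Cvalof
| Crec (ws : seq (fname * value)) (f : fname) (fs : seq (fname * expr)).

Definition fill_expr (C : ectx) (e : expr) : expr :=
  match C with
  | Cfield f => Efield e f
  | Cglobalref => Eglobalref e
  | Cvalof => Evalof e
  | Crec ws f fs => Erec (vals ws ++ (f, e) :: fs)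
  end.

Inductive estep n (home : objid -> 'I_n) (p : 'I_n) :
    econf -> label -> econf -> Prop :=
| estep_new ws o (h : lheap) :
    home o = p -> o \notin domf h ->
    estep home p (ERun (Erec (vals ws)) h) Leps
                 (ERun (Eval (Vobj o)) h.[o <- mkobj ws])
| estep_select o f (h : lheap) (ob : obj) v :
    h.[? o] = Some ob -> ob.[? f] = Some v ->
    estep home p (ERun (Efield (Eval (Vobj o)) f) h) Leps (ERun (Eval v) h)
| estep_select_bad o f (h : lheap) (ob : obj) :
    h.[? o] = Some ob -> f \notin domf ob ->
    estep home p (ERun (Efield (Eval (Vobj o)) f) h) (Lsync exBF) (EDone h)
| estep_globalref o h :
    home o = p ->
    estep home p (ERun (Eglobalref (Eval (Vobj o))) h) Leps
                 (ERun (Eval (Vgref o)) h)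
| estep_valof o h :
    home o = p ->
    estep home p (ERun (Evalof (Eval (Vgref o))) h) Leps
                 (ERun (Eval (Vobj o)) h)
| estep_valof_bad v h :
    (forall o, v = Vgref o -> home o <> p) ->
    estep home p (ERun (Evalof (Eval v)) h) (Lsync exBG) (EDone h)
| estep_ctx C e h l e' h' :
    estep home p (ERun e h) l (ERun e' h') ->
    estep home p (ERun (fill_expr C e) h) l (ERun (fill_expr C e') h')
| estep_ctx_exn C e h l h' :
    estep home p (ERun e h) l (EDone h') ->
    estep home p (ERun (fill_expr C e) h) l (EDone h').

Inductive sctx (n : nat) :=
| Cval (x : var) (s : stmt n)
| Cassign_l (f : fname) (e1 : expr)
| Cassign_r (o : objid) (f : fname)
| Cat (q : 'I_n) (x : var) (s : stmt n).

Definition fill_stmt n (C : sctx n) (e : expr) : stmt n :=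
  match C with
  | Cval x s => Sval x e s
  | Cassign_l f e1 => Sassign e f e1
  | Cassign_r o f => Sassign (Eval (Vobj o)) f e
  | Cat q x s => Sat q x e s
  end.

Inductive step n (home : objid -> 'I_n) :
    'I_n -> conf n -> label -> conf n -> Prop :=
| step_skip p (g : gheap n) :
    p \in domf g ->
    step home p (Run Sskip g) Leps (Done g)
| step_throw p v (g : gheap n) :
    p \in domf g ->
    step home p (Run (Sthrow v) g) (Lsync v) (Done g)
| step_val p x v s (g : gheap n) l s' g' :
    p \in domf g ->
    step home p (Run (subst_stmt x v s) g) l (Run s' g') ->
    step home p (Run (Sval x (Eval v) s) g) l (Run s' g')
| step_val_term p x v s (g : gheap n) l g' :
    p \in domf g ->
    step home p (Run (subst_stmt x v s) g) l (Done g') ->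
    step home p (Run (Sval x (Eval v) s) g) l (Done g')
| step_assign p o f v (g : gheap n) (h : lheap) (ob : obj) :
    g.[? p] = Some h -> h.[? o] = Some ob -> f \in domf ob ->
    step home p (Run (Sassign (Eval (Vobj o)) f (Eval v)) g) Leps
                (Done g.[p <- h.[o <- ob.[f <- v]]])
| step_assign_bad p o f v (g : gheap n) (h : lheap) (ob : obj) :
    g.[? p] = Some h -> h.[? o] = Some ob -> f \notin domf ob ->
    step home p (Run (Sassign (Eval (Vobj o)) f (Eval v)) g) (Lsync exBF)
                (Done g)
| step_ctx p (C : sctx n) e (g : gheap n) (h : lheap) l e' h' :
    g.[? p] = Some h ->
    estep home p (ERun e h) l (ERun e' h') ->
    step home p (Run (fill_stmt C e) g) l (Run (fill_stmt C e') g.[p <- h'])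
| step_ctx_exn p (C : sctx n) e (g : gheap n) (h : lheap) l h' :
    g.[? p] = Some h ->
    estep home p (ERun e h) l (EDone h') ->
    step home p (Run (fill_stmt C e) g) l (Done g.[p <- h'])
| step_place_failure p s (g : gheap n) :
    p \in domf g -> val p != 0 ->
    step home p (Run s g) Leps (Run s g.[~ p])
| step_skip_failed p (g : gheap n) :
    p \notin domf g ->
    step home p (Run Sskip g) (Lsync exDP) (Done g)
| step_throw_failed p v (g : gheap n) :
    p \notin domf g ->
    step home p (Run (Sthrow v) g) (Lsync exDP) (Done g)
| step_val_failed p x e s (g : gheap n) :
    p \notin domf g ->
    step home p (Run (Sval x e s) g) (Lsync exDP) (Done g)
| step_assign_failed p e1 f e2 (g : gheap n) :
    p \notin domf g ->
    step home p (Run (Sassign e1 f e2) g) (Lsync exDP) (Done g)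
| step_spawn p s (g : gheap n) :
    p \in domf g ->
    step home p (Run (Sasync s) g) Leps (Run (SasyncD s) g)
| step_spawn_failed p s (g : gheap n) :
    p \notin domf g ->
    step home p (Run (Sasync s) g) (Lsync exDP) (Done g)
| step_async p s (g : gheap n) l s' g' :
    step home p (Run s g) l (Run s' g') ->
    step home p (Run (SasyncD s) g) (async_label l) (Run (SasyncD s') g')
| step_async_term p s (g : gheap n) l g' :
    step home p (Run s g) l (Done g') ->
    step home p (Run (SasyncD s) g) (async_label l) (Done g')
| step_finish p mu s (g : gheap n) l s' g' :
    step home p (Run s g) l (Run s' g') ->
    step home p (Run (Sfinish mu s) g) Leps
                (Run (Sfinish (add_label mu l) s') g')
| step_finish_end p mu s (g : gheap n) l g' :
    step home p (Run s g) l (Done g') ->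
    step home p (Run (Sfinish mu s) g)
                (if add_label mu l == set0 then Leps
                 else if p \in domf g then Lsync exE else Lsync exDP)
                (Done g')
| step_seq p s t (g : gheap n) l s' g' :
    step home p (Run s g) l (Run s' g') -> ~~ is_Lsync l ->
    step home p (Run (Sseq s t) g) l (Run (Sseq s' t) g')
| step_seq_exn p s t (g : gheap n) v s' g' :
    step home p (Run s g) (Lsync v) (Run s' g') ->
    step home p (Run (Sseq s t) g) (Lsync v) (Run s' g')
| step_par p s t (g : gheap n) l s' g' :
    isAsync t -> step home p (Run s g) l (Run s' g') ->
    step home p (Run (Sseq t s) g) l (Run (Sseq t s') g')
| step_par_term p s t (g : gheap n) l g' :
    isAsync t -> step home p (Run s g) l (Done g') ->
    step home p (Run (Sseq t s) g) l (Run t g')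
| step_seq_term p s t (g : gheap n) l g' :
    p \in domf g -> step home p (Run s g) l (Done g') -> ~~ is_Lsync l ->
    step home p (Run (Sseq s t) g) l (Run t g')
| step_seq_term_exn p s t (g : gheap n) v g' :
    p \in domf g -> step home p (Run s g) (Lsync v) (Done g') ->
    step home p (Run (Sseq s t) g) (Lsync v) (Done g')
| step_seq_failed_sync p s t (g : gheap n) l g' :
    p \notin domf g -> step home p (Run s g) l (Done g') -> isSync s ->
    step home p (Run (Sseq s t) g) (Lsync exDP) (Done g')
| step_seq_failed_async p s t (g : gheap n) l g' :
    p \notin domf g -> step home p (Run s g) l (Done g') -> isAsync s ->
    step home p (Run (Sseq s t) g) (Lasync exDP) (Run t g')
| step_shift p q x v s (g : gheap n) v' g' :
    p \in domf g -> q \in domf g -> copy home v q g v' g' ->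
    step home p (Run (Sat q x (Eval v) s) g) Leps
                (Run (SatD q (Sseq (subst_stmt x v' s) Sskip)) g')
| step_shift_failed p q x e s (g : gheap n) :
    (q \notin domf g) || (p \notin domf g) ->
    step home p (Run (Sat q x e s) g) (Lsync exDP) (Done g)
| step_at p q s (g : gheap n) l s' g' :
    step home q (Run s g) l (Run s' g') ->
    step home p (Run (SatD q s) g)
                (if is_Lsync l && (p \notin domf g) then Lsync exDP else l)
                (Run (SatD q s') g')
| step_at_term p q s (g : gheap n) l g' :
    step home q (Run s g) l (Done g') ->
    step home p (Run (SatD q s) g)
                (if is_Lsync l && (p \notin domf g) then Lsync exDP else l)
                (Done g')
| step_try p s t (g : gheap n) l s' g' :
    step home p (Run s g) l (Run s' g') -> ~~ is_Lsync l ->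
    step home p (Run (Stry s t) g) l (Run (Stry s' t) g')
| step_try_term p s t (g : gheap n) l g' :
    step home p (Run s g) l (Done g') -> ~~ is_Lsync l ->
    step home p (Run (Stry s t) g) l (Done g')
| step_catch p s t (g : gheap n) v s' g' :
    p \in domf g -> step home p (Run s g) (Lsync v) (Run s' g') ->
    step home p (Run (Stry s t) g) Leps (Run (Sseq s' t) g')
| step_catch_term p s t (g : gheap n) v g' :
    p \in domf g -> step home p (Run s g) (Lsync v) (Done g') ->
    step home p (Run (Stry s t) g) Leps (Run t g')
| step_try_failed p s t (g : gheap n) s' g' :
    p \notin domf g -> step home p (Run s g) (Lsync exDP) (Run s' g') ->
    step home p (Run (Stry s t) g) (Lsync exDP) (Run s' g')
| step_try_failed_term p s t (g : gheap n) g' :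
    p \notin domf g -> step home p (Run s g) (Lsync exDP) (Done g') ->
    step home p (Run (Stry s t) g) (Lsync exDP) (Done g').

Definition env_move n (home : objid -> 'I_n) (Phi : gheap n -> gheap n) : Prop :=
  forall g : gheap n,
    (place_local home g -> place_local home (Phi g)) /\
    domf (Phi g) `<=` domf g /\
    (forall p (h h' : lheap), g.[? p] = Some h -> (Phi g).[? p] = Some h' ->
       domf h `<=` domf h').

Definition eps_steps n (home : objid -> 'I_n) (p : 'I_n) :
    conf n -> conf n -> Prop :=
  clos_refl_trans (conf n) (fun k k' => step home p k Leps k').

Definition weak_step n (home : objid -> 'I_n) (p : 'I_n)
    (k : conf n) (l : label) (k' : conf n) : Prop :=
  if l is Leps then eps_steps home p k k'
  else exists k1 k2,
    [/\ eps_steps home p k k1, step home p k1 l k2 & eps_steps home p k2 k'].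

Definition closed_conf n (k : conf n) : Prop :=
  if k is Run s _ then wf_stmt s /\ closed_stmt s else True.

Definition weak_bisimulation n (home : objid -> 'I_n)
    (R : conf n -> conf n -> Prop) : Prop :=
  (forall k k', R k k' -> closed_conf k /\ closed_conf k') /\
  (forall g k, R (Done g) k -> k = Done g) /\
  (forall s g k, R (Run s g) k ->
     exists t, k = Run t g /\ isSync s = isSync t /\
     forall Phi, env_move home Phi -> forall (p : 'I_n) (l : label),
       (forall s' g', step home p (Run s (Phi g)) l (Run s' g') ->
          exists2 t', weak_step home p (Run t (Phi g)) l (Run t' g')
                    & R (Run s' g') (Run t' g')) /\
       (forall t' g', step home p (Run t (Phi g)) l (Run t' g') ->
          exists2 s', weak_step home p (Run s (Phi g)) l (Run s' g')
                    & R (Run s' g') (Run t' g')) /\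
       (forall g', step home p (Run s (Phi g)) l (Done g') ->
          weak_step home p (Run t (Phi g)) l (Done g')) /\
       (forall g', step home p (Run t (Phi g)) l (Done g') ->
          weak_step home p (Run s (Phi g)) l (Done g'))).

Definition weak_bisimilar n (home : objid -> 'I_n) (k k' : conf n) : Prop :=
  exists2 R, weak_bisimulation home R & R k k'.

Lemma weak_bisimilar_largest n (home : objid -> 'I_n) :
  weak_bisimulation home (weak_bisimilar home) /\
  (forall R, weak_bisimulation home R ->
     forall k k', R k k' -> weak_bisimilar home k k').
Proof.
split; last by move=> R bR k k' Rkk'; exists R.
split; first by move=> k k' [R [cR _] Rkk']; exact: cR.
split; first by move=> g k [R [_ [dR _]] Rgk]; exact: dR.
move=> s g k [R bR Rsk]; have [_ [_ rR]] := bR.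
have [t [-> [st H]]] := rR _ _ _ Rsk.
exists t; do 2!split=> //; move=> Phi envPhi p l.
have [H1 [H2 H3]] := H _ envPhi p l.
split; [|split=> //].
- move=> s' g' /H1[t' wt Rt]; exists t' => //; by exists R.
- move=> t' g' /H2[s' ws Rs]; exists s' => //; by exists R.
Qed.

(* Main.v *)
From Stdlib Require Import Relations.
From mathcomp Require Import finmap.
Require Import Defs.
From mathcomp Require Import all_boot.

(** The relation containing all pairs [({skip s}, s)], with [s] free of async
    and of overlined at, and the identity on closed statements is a weak
    bisimulation. At a live place, [{skip s}] reaches [s] silently.  At a failed
    place, the only transition of such an [s] terminates it at once with a
    synchronous [exDP], which is also what [{skip s}] does there. *)

Lemma fv_subst_expr (x : var) (v : value) (e : expr) :
  fv_expr (subst_expr x v e) = filter (predC1 x) (fv_expr e).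
Proof.
(* [Erec] nests expressions in a list, for which the generated induction principle gives no
   hypothesis; hence the explicit fixpoint. *)
move: e; fix IH 1 => -[w|y|e f|fs|e|e] /=; try exact: IH.
- by [].
- by case: eqP => [->|/eqP ne] /=; rewrite ?eqxx //= ne.
- elim: fs => [|[f e] fs IHfs] //=.
  by rewrite filter_cat IH IHfs.
Qed.

Lemma fv_subst_stmt (n : nat) (x : var) (v : value) (s : stmt n) :
  fv_stmt (subst_stmt x v s) = filter (predC1 x) (fv_stmt s).
Proof.
(* If the binder shadows [x], the body is untouched and filtering by [x] twice is idempotent;
   otherwise the two filters commute. *)
have bind y (s1 : stmt n) :
    fv_stmt (subst_stmt x v s1) = filter (predC1 x) (fv_stmt s1) ->
    filter (predC1 y) (fv_stmt (if y == x then s1 else subst_stmt x v s1))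
    = filter (predC1 x) (filter (predC1 y) (fv_stmt s1)).
  by case: eqP => [->|_] IH; rewrite ?filter_id // IH -!filter_predI;
    apply: eq_filter => z /=; rewrite andbC.
by elim: s => //= [y e s IH|e f e'|s -> t ->|q y e s IH|s -> t ->];
  rewrite ?filter_cat ?fv_subst_expr ?bind.
Qed.

Lemma wf_subst_stmt (n : nat) (x : var) (v : value) (s : stmt n) :
  wf_stmt s -> wf_stmt (subst_stmt x v s).
Proof.
have bind y (s1 : stmt n) : (wf_stmt s1 -> wf_stmt (subst_stmt x v s1)) ->
    all (pred1 y) (fv_stmt s1) && wf_stmt s1 ->
    let s2 := if y == x then s1 else subst_stmt x v s1 in
    all (pred1 y) (fv_stmt s2) && wf_stmt s2.
  case: eqP => //= _ IH /andP[fvs1 /IH ->]; rewrite andbT fv_subst_stmt.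
  by rewrite all_filter; apply: sub_all fvs1 => z /= ->; rewrite implybT.
elim: s => //= [y e s IH|s IHs t IHt|q y e s IH|s IHs t IHt].
- exact: bind.
- by case/andP=> /IHs -> /IHt ->.
- exact: bind.
- by case/andP=> /IHs -> /IHt ->.
Qed.

Lemma estep_fv (n : nat) (home : objid -> 'I_n) (p : 'I_n) k l k' :
  estep home p k l k' ->
  match k, k' with
  | ERun e _, ERun e' _ => {subset fv_expr e' <= fv_expr e}
  | _, _ => True
  end.
Proof.
elim=> // -[f| | |ws f fs] e h l1 e' h' _ IH //=.
move=> y; rewrite !map_cat !flatten_cat /= !mem_cat.
by case/or3P=> [->|/IH->|->]; rewrite ?orbT.
Qed.

(** Rules rearrange or drop subterms, and substituting a value for a bound variable only removes
    that variable. *)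
Lemma step_wf_fv (n : nat) (home : objid -> 'I_n) (p : 'I_n) k l k' :
  step home p k l k' ->
  match k, k' with
  | Run s _, Run s' _ =>
      wf_stmt s -> wf_stmt s' /\ {subset fv_stmt s' <= fv_stmt s}
  | _, _ => True
  end.
Proof.
have catl (A B C : seq var) : {subset A <= B} -> {subset A ++ C <= B ++ C}.
  by move=> AB y; rewrite !mem_cat => /orP[/AB->|->]; rewrite ?orbT.
have catr (A B C : seq var) : {subset A <= B} -> {subset C ++ A <= C ++ B}.
  by move=> AB y; rewrite !mem_cat => /orP[->|/AB->]; rewrite ?orbT.
have inl (A B C : seq var) : {subset A <= B} -> {subset A <= B ++ C}.
  by move=> AB y /AB; rewrite mem_cat => ->.
have inr (A B : seq var) : {subset B <= A ++ B}.
  by move=> y; rewrite mem_cat orbC => ->.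
elim=> {p k l k'} //=; try by move=> *; split.
- move=> p x v s g l s' g' _ _ IH /andP[_ /(wf_subst_stmt _ x v)/IH[wfs' sub]].
  by split=> // y /sub; rewrite fv_subst_stmt.
- move=> p [x s|f e1|o f|q x s] e g h l e' h' _ /estep_fv sub //= wfs;
    by split=> //; try exact: catl.
- by move=> p s t g l s' g' _ IH _ /andP[/IH[-> sub] ->]; split=> //; exact: catl.
- by move=> p s t g v s' g' _ IH /andP[/IH[-> sub] _]; split=> //; exact: inl.
- by move=> p s t g l s' g' _ _ IH /andP[-> /IH[-> sub]]; split=> //; exact: catr.
- by move=> p s t g l g' _ _ _ /andP[-> _]; split=> //; exact: inl.
- by move=> p s t g l g' _ _ _ _ /andP[_ ->].
- by move=> p s t g l g' _ _ _ _ /andP[_ ->].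
(* Every value is closed, so substituting the copy [v'] has the same effect on free variables as
   substituting [v]. *)
- move=> p q x v s g v' g' _ _ _ /andP[_ wfs].
  rewrite wf_subst_stmt // cats0 fv_subst_stmt; split=> //; exact: inr.
- by move=> p s t g l s' g' _ IH _ /andP[/IH[-> sub] ->]; split=> //; exact: catl.
- by move=> p s t g v s' g' _ _ IH /andP[/IH[-> sub] ->]; split=> //; exact: catl.
- by move=> p s t g v g' _ _ _ /andP[_ ->].
- by move=> p s t g s' g' _ _ IH /andP[/IH[-> sub] _]; split=> //; exact: inl.
Qed.

Lemma step_closed (n : nat) (home : objid -> 'I_n) p k l k' :
  step home p k l k' -> closed_conf k -> closed_conf k'.
Proof.
case: k k' => [s g|g] [s' g'|g'] // st; last by inversion st.
case=> wfs cs; have [wfs' sub] := step_wf_fv _ _ _ _ _ _ st wfs.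
split=> //; rewrite /closed_stmt; move: sub; rewrite cs.
by case: (fv_stmt s') => // y ys /(_ y); rewrite mem_head => /(_ isT).
Qed.

Lemma noAsync_isAsync (n : nat) (s : stmt n) : noAsync s -> isAsync s = false.
Proof. by elim: s => //= [s IHs t _|s IHs t _] /andP[/IHs->]. Qed.

(** Serves twice: [{skip s}] is synchronous thanks to [Sskip], so [s] must be too; and it selects
    the synchronous rule when a sequence terminates at a failed place. *)
Lemma static_isSync (n : nat) (s : stmt n) : noAsync s -> isLocal s -> isSync s.
Proof.
by elim: s => //= [s IHs t _|s IHs t _] /andP[nas _] /andP[ls _];
  rewrite IHs.
Qed.

(** By induction on the step: no component can keep running, so every compound terminates with it.
    An overlined at could go on running at a live place, and an overlined async would change the
    label to an asynchronous one; the two syntactic conditions exclude both. *)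
Lemma step_failed_place (n : nat) (home : objid -> 'I_n) (p : 'I_n) k l k' :
  step home p k l k' ->
  match k with
  | Run s g => p \notin domf g -> noAsync s -> isLocal s ->
      l = Lsync exDP /\ k' = Done g
  | Done _ => True
  end.
Proof.
(* Assignment and context rules express liveness by a heap lookup instead of domain membership. *)
have live q (g : gheap n) h : g.[? q]%fmap = Some h -> q \notin domf g -> False.
  by move=> gq /not_fnd; rewrite gq.
elim=> {p k l k'} //=; try by move=> *; match goal with
  | A : is_true (?p \in ?g), B : is_true (?p \notin ?g) |- _ =>
      by rewrite A in B
  end.
- by move=> p o f v g h ob gp _ _ /(live _ _ _ gp).
- by move=> p o f v g h ob gp _ _ /(live _ _ _ gp).
- by move=> p C e g h l e' h' gp _ /(live _ _ _ gp).
- by move=> p C e g h l h' gp _ /(live _ _ _ gp).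
- by move=> p mu s g l s' g' _ IH np na lo; case: (IH np na lo).
- move=> p mu s g l g' _ IH np na lo; case: (IH np na lo) => -> -> /=.
  (* The accumulated set contains [exDP], so the finish cannot end silently; at a failed place its
     label is then [exDP]. *)
  rewrite (negPf np); case: eqP => // /setP/(_ exDP).
  by rewrite !inE eqxx.
- by move=> p s t g l s' g' _ IH _ np /andP[na _] /andP[lo _]; case: (IH np na lo).
- by move=> p s t g v s' g' _ IH np /andP[na _] /andP[lo _]; case: (IH np na lo).
- by move=> p s t g l s' g' at_ _ _ _ /andP[na _]; rewrite noAsync_isAsync in at_.
- by move=> p s t g l g' at_ _ _ _ /andP[na _]; rewrite noAsync_isAsync in at_.
- by move=> p s t g l g' _ _ IH _ np /andP[na _] /andP[lo _]; case: (IH np na lo).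
- by move=> p s t g l g' _ _ _ as_ _ /andP[na _]; rewrite noAsync_isAsync in as_.
- by move=> p s t g l s' g' _ IH _ np /andP[na _] /andP[lo _]; case: (IH np na lo).
- by move=> p s t g l g' _ IH nl np /andP[na _] /andP[lo _];
    case: (IH np na lo) nl => ->.
- by move=> p s t g s' g' _ _ IH np /andP[na _] /andP[lo _]; case: (IH np na lo).
- by move=> p s t g g' _ _ IH np /andP[na _] /andP[lo _]; case: (IH np na lo).
Qed.

(** Existence, complementing the uniqueness in [step_failed_place]: basic forms fail by their own
    rule, and sequence, finish and try inherit the failure of their first component. *)
Lemma failed_place_step (n : nat) (home : objid -> 'I_n) (p : 'I_n)
    (g : gheap n) (s : stmt n) :
  p \notin domf g -> noAsync s -> isLocal s ->
  step home p (Run s g) (Lsync exDP) (Done g).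
Proof.
move=> np; elim: s => //=.
- by move=> *; exact: step_skip_failed.
- by move=> *; exact: step_throw_failed.
- by move=> *; exact: step_val_failed.
- by move=> *; exact: step_assign_failed.
- move=> s IHs t _ /andP[na _] /andP[lo _].
  exact: step_seq_failed_sync np (IHs na lo) (static_isSync _ _ na lo).
- by move=> *; apply: step_shift_failed; rewrite np orbT.
- move=> mu s IHs na lo.
  have := step_finish_end mu (IHs na lo); rewrite (negPf np) /=.
  by case: eqP => // /setP/(_ exDP); rewrite !inE eqxx.
- move=> s IHs t _ /andP[na _] /andP[lo _].
  exact: step_try_failed_term np (IHs na lo).
Qed.

Lemma step_Sskip (n : nat) (home : objid -> 'I_n) (p : 'I_n) (g : gheap n) l k :
  step home p (Run Sskip g) l k ->
  [\/ [/\ p \in domf g, val p != 0, l = Leps & k = Run Sskip g.[~ p]%fmap],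
      [/\ p \in domf g, l = Leps & k = Done g] |
      [/\ p \notin domf g, l = Lsync exDP & k = Done g]].
Proof.
move=> st; inversion st; subst; try match goal with
  | E : fill_stmt ?C _ = _ |- _ => by destruct C
  end.
- exact: Or32.
- exact: Or31.
- exact: Or33.
Qed.

Lemma step_Sseq_Sskip (n : nat) (home : objid -> 'I_n) (p : 'I_n) (g : gheap n)
    (s : stmt n) l k :
  step home p (Run (Sseq Sskip s) g) l k ->
  [\/ [/\ p \in domf g, val p != 0, l = Leps & k = Run (Sseq Sskip s) g.[~ p]%fmap],
      [/\ p \in domf g, l = Leps & k = Run s g] |
      [/\ p \notin domf g, l = Lsync exDP & k = Done g]].
Proof.
move=> st; inversion st; subst => //; try match goal with
  | E : fill_stmt ?C _ = _ |- _ => by destruct C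
  end.
- exact: Or31.
all: match goal with E : step _ _ (Run Sskip _) _ _ |- _ =>
  case: (step_Sskip _ _ _ _ _ _ E) => -[] end; try done.
(* Place failure applied to the inner [Sskip] has the same outcome as place failure applied to the
   whole sequence. *)
- by move=> ? ? -> [-> ->]; exact: Or31.
- by move=> ? -> [->]; exact: Or32.
- by case/negP.
- by case/negP.
- by move=> pg; match goal with np : is_true (_ \notin _) |- _ => case/negP: np end.
- by move=> ? _ [->]; exact: Or33.
Qed.

Lemma weak_step1 (n : nat) (home : objid -> 'I_n) p k l k' :
  step home p k l k' -> weak_step home p k l k'.
Proof.
case: l => [|v|v] st; [exact: rt_step|..];
  by exists k, k'; split=> //; exact: rt_refl.
Qed.

Lemma weak_step_eps (n : nat) (home : objid -> 'I_n) p k k1 l k' :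
  step home p k Leps k1 -> step home p k1 l k' -> weak_step home p k l k'.
Proof.
case: l => [|v|v] st st'; first by apply: rt_trans; apply: rt_step; eassumption.
  by exists k1, k'; split=> //; [exact: rt_step|exact: rt_refl].
by exists k1, k'; split=> //; [exact: rt_step|exact: rt_refl].
Qed.

(** Identity pairs are restricted only by closedness, since a step of [s] may create an overlined
    at. *)
Inductive skip_rel (n : nat) : conf n -> conf n -> Prop :=
| skip_rel_skip s g :
    wf_stmt s -> closed_stmt s -> noAsync s -> isLocal s ->
    skip_rel n (Run (Sseq Sskip s) g) (Run s g)
| skip_rel_id s g :
    closed_conf (Run s g) -> skip_rel n (Run s g) (Run s g).

Lemma weak_bisimulation_skip_rel (n : nat) (home : objid -> 'I_n) :
  weak_bisimulation home (skip_rel n).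
Proof.
split; first by move=> _ _ [s g wfs cs na lo|s g cs].
split; first by move=> g k r; inversion r.
(* An environment move only replaces the heap by [Phi g], so the four clauses are proved at an
   arbitrary heap. *)
suff skipP s g : wf_stmt s -> closed_stmt s -> noAsync s -> isLocal s ->
    forall (p : 'I_n) (l : label),
       (forall s' g', step home p (Run (Sseq Sskip s) g) l (Run s' g') ->
          exists2 t', weak_step home p (Run s g) l (Run t' g')
                    & skip_rel n (Run s' g') (Run t' g')) /\
       (forall t' g', step home p (Run s g) l (Run t' g') ->
          exists2 s', weak_step home p (Run (Sseq Sskip s) g) l (Run s' g')
                    & skip_rel n (Run s' g') (Run t' g')) /\
       (forall g', step home p (Run (Sseq Sskip s) g) l (Done g') ->
          weak_step home p (Run s g) l (Done g')) /\
       (forall g', step home p (Run s g) l (Done g') ->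
          weak_step home p (Run (Sseq Sskip s) g) l (Done g')).
  move=> s g k r; inversion r as [s1 g1 wfs cs na lo|s1 g1 cs]; subst.
    by exists s1; split=> //; split; [rewrite /= static_isSync|move=> *; exact: skipP].
  exists s; do 2!split=> //; move=> Phi _ p l.
  have sim s' g' : step home p (Run s (Phi g)) l (Run s' g') ->
      exists2 t', weak_step home p (Run s (Phi g)) l (Run t' g')
                & skip_rel n (Run s' g') (Run t' g').
    move=> st; exists s'; first exact: weak_step1.
    by apply: skip_rel_id; exact: step_closed st cs.
  do 2!split=> //; last by split=> g' st; exact: weak_step1.
  move=> s' g' st; exists s'; first exact: weak_step1.
  by apply: skip_rel_id; exact: step_closed st cs.
move=> wfs cs na lo p l.
have skip_eps : p \in domf g -> step home p (Run (Sseq Sskip s) g) Leps (Run s g).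
  by move=> pg; apply: step_seq_term => //; exact: step_skip.
split; [|split; [|split]].
- move=> s' g' /step_Sseq_Sskip[][] // pg.
    (* Place failure is answered by place failure, which leads to another skip pair; consuming
       [Sskip] is answered by no step at all. *)
    move=> p0 -> [-> ->]; exists s; last exact: skip_rel_skip.
    exact/weak_step1/step_place_failure.
  by move=> -> [-> ->]; exists s; [exact: rt_refl|exact: skip_rel_id].
- move=> t' g' st; exists t'; last by apply: skip_rel_id; exact: step_closed st _.
  (* At a live place [Sskip] is consumed silently before the step is replayed; at a failed one [s]
     cannot step to a running configuration. *)
  have [pg|np] := boolP (p \in domf g).
    exact: weak_step_eps (skip_eps pg) st.
  by have [] := step_failed_place _ _ _ _ _ _ st np na lo.
- move=> g' /step_Sseq_Sskip[][] // np -> [->].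
  exact/weak_step1/failed_place_step.
- move=> g' st; have [pg|np] := boolP (p \in domf g).
    exact: weak_step_eps (skip_eps pg) st.
  have [-> [->]] := step_failed_place _ _ _ _ _ _ st np na lo.
  (* [{skip s}] inherits both syntactic conditions from [s], so it fails in the same way. *)
  by apply/weak_step1/failed_place_step; rewrite //= ?na ?lo.
Qed.

Theorem mainTheorem19 (n : nat) (home : objid -> 'I_n) (s : stmt n) (g : gheap n) :
  wf_stmt s -> closed_stmt s -> noAsync s -> isLocal s ->
  weak_bisimilar home (Run (Sseq Sskip s) g) (Run s g).
Proof.
move=> wfs cs na lo; exists (skip_rel n).
  exact: weak_bisimulation_skip_rel.
exact: skip_rel_skip.
Qed.
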